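(* Let $G$ be a graph with $n$ vertices and $m$ edges whose adjacency matrix has $k$ non-negative eigenvalues (counted with multiplicity). Then $$EE(G)\geq \frac{E(G)}{2}+e^{\lambda_1}+(k-1)-\lambda_1.$$ Equality holds if and only if $G$ is isomorphic to $\overline{K_n}$.
   Context: Graphs are finite, simple and undirected, with at least one vertex. For a graph $G$ on $n$ vertices, $A(G)$ is its $0$-$1$ adjacency matrix, with eigenvalues (with multiplicity) $\lambda_1\geq\dots\geq\lambda_n$. The Estrada index of $G$ is $EE(G)=\sum_{i=1}^n e^{\lambda_i}$ and the energy of $G$ is $E(G)=\sum_{i=1}^n|\lambda_i|$. $\overline{K_n}$ denotes the edgeless graph on $n$ vertices. *)

(* Defs.v *)
From HB Require Import structures.
From mathcomp Require Import all_boot all_order all_algebra.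
From mathcomp Require Import reals.
From mathcomp.analysis Require Import sequences exp.
From mathcomp Require Import polyrcf.

Set Implicit Arguments.
Unset Strict Implicit.
Unset Printing Implicit Defensive.

Import Order.TTheory GRing.Theory Num.Theory.
Local Open Scope ring_scope.

Record sgraph := SGraph {
  vertex :> finType;
  adj : rel vertex;
  adj_sym : symmetric adj;
  adj_irrefl : irreflexive adj
}.

Definition edges (G : sgraph) : {set {set G}} :=
  [set [set p.1; p.2] | p : G * G & adj p.1 p.2].

Definition isomorphic (G H : sgraph) : Prop :=
  exists2 f : G -> H, bijective f & forall x y, adj (f x) (f y) = adj x y.

Lemma edgeless_sym n : symmetric (fun _ _ : 'I_n => false).
Proof. by []. Qed.

Lemma edgeless_irrefl n : irreflexive (fun _ : 'I_n => fun _ => false).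
Proof. by []. Qed.

Definition edgeless (n : nat) : sgraph :=
  SGraph (@edgeless_sym n) (@edgeless_irrefl n).

(* Rows and columns are indexed by the enumeration of the vertex type. *)
Definition adjmx (R : realType) (G : sgraph) : 'M[R]_#|G| :=
  \matrix_(i, j) (adj (enum_val i) (enum_val j))%:R.

(* The real roots of the characteristic polynomial, each repeated according to
   its multiplicity, in non-increasing order. A real symmetric n x n matrix has
   only real eigenvalues, so for such a matrix this sequence has n entries. *)
Definition eigenvalues (R : realType) (n : nat) (A : 'M[R]_n) : seq R :=
  let p := char_poly A in
  sort >=%R (flatten [seq nseq (mup x p) x | x <- rootsR p]).

Definition spectrum (R : realType) (G : sgraph) : seq R :=
  eigenvalues (adjmx R G).

(* The sequence is indexed from 0, so this is its first entry. *)
Definition lambda1 (R : realType) (G : sgraph) : R := (spectrum R G)`_0.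

Definition estrada (R : realType) (G : sgraph) : R :=
  \sum_(x <- spectrum R G) expR x.

Definition energy (R : realType) (G : sgraph) : R :=
  \sum_(x <- spectrum R G) `|x|.

(* Main.v *)
(** The adjacency matrix is real symmetric with zero diagonal, so its spectrum
    consists of n real numbers of sum 0; hence E(G)/2 is the sum of the positive
    parts x^+ = (x + |x|)/2 of the eigenvalues, and lambda_1 >= 0. For every real
    x we have x^+ + [0 <= x] <= exp x, with equality only at x = 0: this is
    1 + x <= exp x for x >= 0, and 0 < exp x for x < 0. Summing over all the
    eigenvalues except lambda_1 gives the inequality; equality forces these
    eigenvalues to vanish, hence also lambda_1, hence the adjacency matrix. *)
Require Import Defs.
From mathcomp Require Import all_boot all_order all_algebra.
From mathcomp Require Import reals.
From mathcomp.analysis Require Import sequences exp.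
From mathcomp Require Import complex polyrcf lra.

Set Implicit Arguments.
Unset Strict Implicit.

Import Order.TTheory GRing.Theory Num.Theory.
Local Open Scope ring_scope.

(** Over [R[i]] the matrix is Hermitian, so the spectral theorem diagonalizes it with real diagonal
    entries. Only [P] stays complex. *)
Lemma symmetric_spectral (R : rcfType) n (A : 'M[R]_n) : A^T = A ->
  exists P : 'M[R[i]]_n, exists2 d : 'rV[R]_n, P \in unitmx &
    map_mx (real_complex R) A =
      invmx P *m diag_mx (map_mx (real_complex R) d) *m P.
Proof.
move=> symA; pose B := map_mx (real_complex R) A.
have hermB : B \is hermsymmx.
  apply: realsym_hermsym.
    by apply/is_hermitianmxP; rewrite expr0 scale1r map_mx_id // /B map_trmx symA.
  by apply/mxOverP => i j; rewrite mxE complex_real.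
have /orthomx_spectralP eqB := hermitian_normalmx hermB.
exists (spectralmx B), (map_mx (@complex.Re R) (spectral_diag B)).
  exact: spectral_unit.
rewrite -/B [LHS]eqB; congr (_ *m diag_mx _ *m _).
apply/rowP => i; rewrite !mxE RRe_real //.
exact: (mxOverP (hermitian_spectral_diag_real hermB)).
Qed.

Lemma char_poly_conj (F : fieldType) n (P A : 'M[F]_n) : P \in unitmx ->
  char_poly (invmx P *m A *m P) = char_poly A.
Proof.
move=> unitP; rewrite /char_poly /char_poly_mx !map_mxM /=.
have unitPX : map_mx polyC P \in unitmx by rewrite map_unitmx.
(* The scalar matrix ['X%:M] is conjugated as well, so that [P] factors out of the whole
   characteristic matrix. *)
rewrite map_invmx -[in LHS](mulmxKV unitPX 'X%:M) -scalar_mxC.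
by rewrite -mulmxBl -mulmxBr !det_mulmx det_inv mulrAC mulVr ?mul1r.
Qed.

Lemma char_poly_diag (F : comNzRingType) n (d : 'rV[F]_n) :
  char_poly (diag_mx d) = \prod_(i < n) ('X - (d 0 i)%:P).
Proof.
rewrite char_poly_trig ?diag_mx_is_trig //.
by apply: eq_bigr => i _; rewrite mxE eqxx.
Qed.

(** Each [x] occurs in both lists as often as its multiplicity as a root of the characteristic
    polynomial. *)
Lemma eigenvalues_perm (R : realType) n (A : 'M[R]_n) (s : seq R) :
  char_poly A = \prod_(x <- s) ('X - x%:P) -> perm_eq (eigenvalues A) s.
Proof.
move=> pE; have p_neq0 := monic_neq0 (char_poly_monic A).
rewrite /eigenvalues; set p := char_poly A in pE p_neq0 *.
rewrite perm_sort; apply/allP => x _ /=; apply/eqP.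
rewrite -[RHS]mu_prod_XsubC -pE count_flatten -map_comp sumnE big_map /=.
under eq_bigr => y _ do rewrite count_nseq.
(* [rootsR p] is duplicate-free, so at most one block of the flattened list contains [x]. *)
have [x_root | x_nroot] := boolP (x \in rootsR p).
  rewrite (bigD1_seq x) //=; last exact: uniq_roots.
  by rewrite eqxx mul1n big1 ?addn0 // => y /negbTE /= ->.
rewrite big1_seq => [|y /= y_root].
  rewrite mupNroot //; apply: contra x_nroot => px0.
  by rewrite -(roots_on_rootsR p_neq0) px0 in_itv.
by case: eqP y_root x_nroot => [-> -> //|]; rewrite mul0n.
Qed.

Lemma eigenvalues_sorted (R : realType) n (A : 'M[R]_n) :
  sorted >=%R (eigenvalues A).
Proof. by apply: sort_sorted => x y; exact: le_total. Qed.

(** Each claim is checked over [R[i]] on the diagonalized matrix and pulled back along the injective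
    [real_complex]. *)
Lemma symmetric_eigenvalues (R : realType) n (A : 'M[R]_n) : A^T = A ->
  exists2 d : 'rV[R]_n, perm_eq (eigenvalues A) [seq d 0 i | i : 'I_n] &
    \tr A = \sum_i d 0 i /\ (d = 0 -> A = 0).
Proof.
move=> /symmetric_spectral[P [d unitP eqA]]; exists d.
  apply: eigenvalues_perm; apply: (map_poly_inj (real_complex R)).
  rewrite map_char_poly eqA char_poly_conj // char_poly_diag big_map enumT.
  rewrite rmorph_prod; apply: eq_bigr => i _.
  by rewrite rmorphB /= map_polyX map_polyC /= mxE.
split=> [|d0].
  apply: (@complexI R); rewrite -trace_map_mx eqA mxtrace_mulC mulmxA.
  rewrite mulmxV // mul1mx mxtrace_diag rmorph_sum.
  by apply: eq_bigr => i _; rewrite mxE.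
apply: (@map_mx_inj _ _ (real_complex R)).
by rewrite eqA d0 !(raddf0, mul0mx).
Qed.

Lemma size_eigenvalues (R : realType) n (A : 'M[R]_n) : A^T = A ->
  size (eigenvalues A) = n.
Proof.
move=> /symmetric_eigenvalues[d /perm_size -> _].
by rewrite size_map -cardE card_ord.
Qed.

Lemma sum_eigenvalues (R : realType) n (A : 'M[R]_n) : A^T = A ->
  \sum_(x <- eigenvalues A) x = \tr A.
Proof.
move=> /symmetric_eigenvalues[d dA [-> _]].
by rewrite (perm_big _ dA) /= big_map enumT.
Qed.

Lemma all_eigenvalues_eq0 (R : realType) n (A : 'M[R]_n) : A^T = A ->
  all (pred1 0) (eigenvalues A) = (A == 0).
Proof.
move=> symA; apply/idP/eqP => [eig0 | ->].
  have [d dA [_ A0]] := symmetric_eigenvalues symA.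
  apply: A0; apply/rowP => i; rewrite mxE; apply/eqP.
  apply: (allP eig0); rewrite (perm_mem dA).
  by apply: map_f; rewrite mem_enum.
rewrite (perm_all _ (@eigenvalues_perm _ _ _ (nseq n 0) _)).
  by rewrite all_nseq /= eqxx orbT.
(* As a diagonal matrix, 0 has a characteristic polynomial already split into linear factors. *)
have -> : 0 = diag_mx 0 :> 'M[R]_n by rewrite raddf0.
rewrite char_poly_diag.
transitivity (\prod_(i < n) ('X - (0 : R)%:P)).
  by apply: eq_bigr => i _; rewrite mxE.
by rewrite prodr_const card_ord big_nseq -Monoid.iteropE.
Qed.

Section RealSums.
Variable R : realType.
Implicit Types (x : R) (s : seq R).

Lemma pos_part_expR_leif x :
  (x + `|x|) / 2 + (0 <= x)%R%:R <= expR x ?= iff (x == 0).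
Proof.
apply/leifP; have [-> | x_neq0] := eqVneq x 0.
  by apply/eqP; rewrite expR0 normr0 lexx addr0 mul0r add0r.
have [x_ge0 | x_lt0] := leP 0 x.
  by have := expR_gt1Dx x_neq0; rewrite ger0_norm //=; lra.
by have := expR_gt0 x; rewrite ltr0_norm //=; lra.
Qed.

Lemma sum_pos_part_expR_leif s :
  \sum_(x <- s) (x + `|x|) / 2 + (count (fun x => 0 <= x)%R s)%:R
    <= \sum_(x <- s) expR x ?= iff all (pred1 0) s.
Proof.
elim: s => [|x s IHs]; first by rewrite !big_nil addr0; exact: leif_refl.
by rewrite !big_cons /= natrD addrACA; exact: leifD (pos_part_expR_leif x) IHs.
Qed.

(** A negative head would bound all other entries above, making the sum negative. *)
Lemma head_ge0_of_sum_eq0 x s : sorted >=%R (x :: s) ->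
  \sum_(y <- x :: s) y = 0 -> 0 <= x.
Proof.
move=> /= xs_sorted; rewrite big_cons leNgt => sum0; apply/negP => x_lt0.
suff : \sum_(y <- s) y <= 0 by lra.
rewrite big_seq sumr_le0 // => y ys; apply: le_trans (ltW x_lt0).
by have /allP/(_ y ys) := order_path_min ge_trans xs_sorted.
Qed.

Lemma estrada_leif s : (0 < size s)%N -> sorted >=%R s ->
  \sum_(x <- s) x = 0 ->
  (\sum_(x <- s) `|x|) / 2 + expR s`_0
      + ((count (fun x => 0 <= x)%R s)%:R - 1) - s`_0
    <= \sum_(x <- s) expR x ?= iff all (pred1 0) s.
Proof.
case: s => [//|x s] _ xs_sorted sum0 /=.
have x_ge0 := head_ge0_of_sum_eq0 xs_sorted sum0.
(* The added terms sum to 0. *)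
have -> : (\sum_(y <- x :: s) `|y|) / 2 = \sum_(y <- x :: s) (y + `|y|) / 2.
  by rewrite -mulr_suml big_split /= sum0 add0r.
(* The tail alone decides equality: if it vanishes, the zero sum forces the head to vanish. *)
have -> : (x == 0) && all (pred1 0) s = all (pred1 0) s.
  have [/allP s0 | _] := boolP (all (pred1 0) s); last by rewrite andbF.
  move: sum0; rewrite big_cons big_seq big1 ?addr0 => [->|y /s0/eqP //].
  by rewrite eqxx.
rewrite !big_cons x_ge0 natrD ger0_norm //.
set S := \sum_(y <- s) _; set c := (count _ _)%:R.
(* The head's positive part cancels [- x] and its count cancels [- 1], leaving [expR x] on both
   sides. *)
have -> : (x + x) / 2 + S + expR x + (true%:R + c - 1) - x = expR x + (S + c).
  by rewrite /=; lra.
rewrite -[all _ _]andTb; apply: leifD; first exact/leif_refl.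
exact: sum_pos_part_expR_leif.
Qed.

End RealSums.

Lemma adjmx_sym (R : realType) (G : sgraph) : (adjmx R G)^T = adjmx R G.
Proof. by apply/matrixP => i j; rewrite !mxE adj_sym. Qed.

Lemma mxtrace_adjmx (R : realType) (G : sgraph) : \tr (adjmx R G) = 0.
Proof. by apply: big1 => i _; rewrite mxE adj_irrefl. Qed.

Lemma adjmx_eq0P (R : realType) (G : sgraph) :
  reflect (isomorphic G (edgeless #|G|)) (adjmx R G == 0).
Proof.
apply: (iffP eqP) => [A0 | [f _ fadj]]; last first.
  by apply/matrixP => i j; rewrite !mxE -fadj.
(* The matrix is indexed along the enumeration of the vertices, which also numbers them by
   ['I_#|G|]. *)
exists (@enum_rank G) => [|x y]; first exact: enum_rank_bij.
have /matrixP/(_ (enum_rank x) (enum_rank y)) := A0.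
by rewrite !mxE !enum_rankK; case: (adj x y) => // /eqP; rewrite oner_eq0.
Qed.

Theorem theorem7 (R : realType) (G : sgraph) (n m k : nat)
  (n_gt0 : (0 < n)%N)
  (card_vertices : #|G| = n)
  (card_edges : #|edges G| = m)
  (card_nonneg : count (fun x : R => 0 <= x) (spectrum R G) = k) :
  energy R G / 2 + expR (lambda1 R G) + (k%:R - 1) - lambda1 R G <= estrada R G
  /\ (estrada R G =
        energy R G / 2 + expR (lambda1 R G) + (k%:R - 1) - lambda1 R G
      <-> isomorphic G (edgeless n)).
Proof.
subst n; have symA := adjmx_sym R G.
have := @estrada_leif R (spectrum R G).
(* The spectrum has [#|G|] entries, so it is nonempty and [lambda1] is a genuine eigenvalue, not the
   default of [nth]. *)
rewrite size_eigenvalues // sum_eigenvalues // mxtrace_adjmx.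
rewrite all_eigenvalues_eq0 // card_nonneg.
move=> /(_ n_gt0 (eigenvalues_sorted _) erefl) [le_EE eq_EE].
split=> //; split=> [EE | /(adjmx_eq0P R) A0].
  by apply/(adjmx_eq0P R); rewrite -eq_EE; apply/eqP.
by apply/esym/eqP; rewrite eq_EE.
Qed.
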